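(* Let $K$ be a number field, let $n$ be a positive integer, and let $S$ be a subset of the cyclic group $\mathbb{Z}/n\mathbb{Z}$. Let $\{1,2,\dots,n-1\}=\bigsqcup_{i=1}^{r(n,K)} M_i$ be the partition associated with $(n,K)$ (defined in the context). Then the circulant digraph $D(n,S)$ is integral over $K$ if and only if $S$ is a union of some of the sets $M_i$.
   Context: A number field is a finite extension of $\mathbb{Q}$, here regarded as a subfield of $\mathbb{C}$. Let $\zeta_m=e^{2\pi i/m}$ for $m\ge 1$. Circulant digraph: for a subset $S$ of $\mathbb{Z}/n\mathbb{Z}$, $D(n,S)$ is the directed graph with vertex set $\mathbb{Z}/n\mathbb{Z}$ in which there is an arc from $g_1$ to $g_2$ if and only if $g_2-g_1\in S$. Its eigenvalues are those of its adjacency matrix, namely $\lambda_r=\sum_{s\in S}\zeta_n^{rs}$ for $0\le r\le n-1$. $D(n,S)$ is called integral over $K$ if all its eigenvalues are algebraic integers of $K$. Partition associated with $(n,K)$: elements of $\mathbb{Z}/n\mathbb{Z}$ are represented by the integers $0,1,\dots,n-1$. Let $d(n)$ be the set of positive proper divisors $p$ of $n$, i.e. positive divisors with $p<n$ ($p$ need not be prime). Let $F=K\cap\mathbb{Q}(\zeta_n)$. For $p\in d(n)$ put $g=n/p$ and $G_n(p)=\{x : 1\le x<n,\ \gcd(x,n)=p\}$, so that $G_n(p)=p\cdot(\mathbb{Z}/g\mathbb{Z})^{*}$ (i.e. $x=px'$ with $x'$ a unit modulo $g$). Let $G'_p=\mathrm{Gal}(\mathbb{Q}(\zeta_g)/F\cap\mathbb{Q}(\zeta_g))$.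 Each $\sigma\in G'_p$ satisfies $\sigma(\zeta_g)=\zeta_g^{a}$ for a unique $a=a(\sigma)\in(\mathbb{Z}/g\mathbb{Z})^{*}$, and $G'_p$ acts on $G_n(p)$ by $\sigma\cdot(px')=p\,(a(\sigma)x' \bmod g)$, with residues modulo $g$ represented in $\{1,\dots,g-1\}$. The number of orbits of this action is $r_p=[F\cap\mathbb{Q}(\zeta_g):\mathbb{Q}]$. Since $\{1,\dots,n-1\}=\bigsqcup_{p\in d(n)}G_n(p)$, the orbits of all these actions, over all $p\in d(n)$, form a partition of $\{1,\dots,n-1\}$; they are denoted $M_1,\dots,M_{r(n,K)}$, where $r(n,K)=\sum_{p\in d(n)}r_p$.
   Formalization: The right-hand side reads ''S without 0 is a union of some of the sets M_i'' instead of ''S is a union'', because for S = {0} all eigenvalues are 1, so D(n,S) is integral over K, yet no M_i contains 0; for 0 not in S nothing changes. *)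

(* Defs.v *)
From HB Require Import structures.
From mathcomp Require Import all_boot all_order all_fingroup all_algebra.
From mathcomp Require Import all_solvable all_field.

Set Implicit Arguments.
Unset Strict Implicit.
Unset Printing Implicit Defensive.
Import Order.TTheory GRing.Theory Num.Theory.
Local Open Scope ring_scope.

(* zeta m = e^(2 pi i / m) for m >= 1. The library fixes m.-root x as the m-th  *)
(* root of x of least nonnegative argument, so m.-root (-1) = e^(pi i / m).    *)
Definition zeta (m : nat) : algC := (m.-root (-1)) ^+ 2.

(* A number field K, regarded as a subfield of the complex numbers through     *)
(* jC (every algebraic number lies in algC), placed together with zeta m in a  *)
(* Galois extension of Q inside algC: all the fields below are subfields of    *)
(* nf_field, where the subfields and Galois groups of the library live.       *)
Record normal_frame (K : fieldExtType rat) (jC : {rmorphism K -> algC})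
    (m : nat) := NormalFrame {
  nf_field : splittingFieldType rat;
  nf_val : {rmorphism nf_field -> algC};
  nf_inc : 'AHom(K, nf_field);
  nf_zeta : nf_field;
  nf_incP : forall x, nf_val (nf_inc x) = jC x;
  nf_zetaP : nf_val nf_zeta = zeta m
}.

Lemma normal_frame_exists (K : fieldExtType rat)
    (jC : {rmorphism K -> algC}) (m : nat) : normal_frame jC m.
Proof.
pose b := vbasis {:K}.
pose s := zeta m :: map jC b.
have minP (x : algC) :
    {p : {poly rat} | p \is monic & root (map_poly ratr p : {poly algC}) x}.
  have [p [_ mon_p] /(_ p) pz0] := minCpolyP x.
  by exists p => //; rewrite pz0 dvdpp.
pose q := \prod_(x <- s) s2val (minP x).
have mon_q : q \is monic.
  by apply: monic_prod => x _; case: (minP x).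
have qs x : x \in s -> root (map_poly ratr q : {poly algC}) x.
  move=> sx; rewrite /q (big_rem x sx) /= rmorphM rootM.
  by case: (minP x) => /= p _ ->.
have [r Dr] := closed_field_poly_normal (map_poly ratr q : {poly algC}).
rewrite lead_coef_map (monicP mon_q) rmorph1 scale1r in Dr.
have rs x : x \in s -> x \in r by move/qs; rewrite Dr root_prod_XsubC.
have [L [LC [rr Drr genL]]] := num_field_exists r.
have ratLC a : LC a%:A = ratr a by rewrite alg_num_field fmorph_rat.
have splitL : SplittingField.axiom L.
  exists (map_poly (in_alg L) q).
    by apply/polyOverP=> i; rewrite coef_map memvZ ?memv_line.
  exists rr; last exact: genL.
  suffices ->: map_poly (in_alg L) q = \prod_(z <- rr) ('X - z%:P).
    exact: eqpxx.
  apply: (map_poly_inj LC); rewrite -map_poly_comp.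
  rewrite (eq_map_poly (ratLC : LC \o in_alg L =1 ratr)).
  rewrite Dr -Drr big_map rmorph_prod /=; apply: eq_bigr => z _.
  by rewrite map_polyXsubC.
have liftL x : x \in s -> {y | LC y = x}.
  by move/rs; rewrite -Drr => /mapP/sig2_eqW[y _ ->]; exists y.
have [z Dz] := liftL (zeta m) (mem_head _ _).
have incP (y : K) : {x | LC x = jC y}.
  have lb (i : 'I_(\dim {:K})) : {x | LC x = jC b`_i}.
    apply: liftL; rewrite inE; apply/orP; right; apply: map_f.
    by rewrite mem_nth // size_tuple.
  exists (\sum_i coord b i y *: sval (lb i)).
  rewrite {2}(coord_vbasis (memvf y)) !rmorph_sum /=; apply: eq_bigr => i _.
  by rewrite !rmorphZ_num; case: (lb i) => x /= ->.
pose inc y := sval (incP y).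
have Dinc y : LC (inc y) = jC y by rewrite /inc; case: (incP y).
pose rwM := (Dinc, rmorphZ_num, rmorph1, rmorphB, rmorphM).
have inca : zmod_morphism inc.
  by move=> ? ?; apply: (fmorph_inj LC); rewrite !rwM.
have incm : monoid_morphism inc.
  by split; try move=> ? ?; apply: (fmorph_inj LC); rewrite !rwM /= ?rwM.
have incl : scalable inc.
  by move=> ? ?; apply: (fmorph_inj LC); rewrite !rwM.
pose incaM := GRing.isZmodMorphism.Build _ _ inc inca.
pose incmM := GRing.isMonoidMorphism.Build _ _ inc incm.
pose inclM := GRing.isScalable.Build _ _ _ _ inc incl.
pose incLR : {lrmorphism _ -> _} := HB.pack inc incaM incmM inclM.
pose LM := FieldExt_isSplittingField.Build rat L splitL.
pose Ls : splittingFieldType rat := HB.pack (FieldExt.sort L) LM.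
exists (Ls : splittingFieldType rat) LC (linfun_ahom incLR) z => // x.
by rewrite -Dinc; congr (LC _); apply: (lfunE incLR).
Qed.

Section CirculantDigraph.

Variable n : nat.

(* Z/(n+1)Z is 'I_n.+1, whose zmodType structure is addition modulo n+1; the   *)
(* underlying naturals are the representatives 0, ..., n. ('Z_m would be wrong *)
(* for m = 1, as 'Z_1 is Z/2Z.)                                                *)
Definition circulant (S : {set 'I_n.+1}) : rel 'I_n.+1 :=
  fun g1 g2 => g2 - g1 \in S.

Definition adjacency (e : rel 'I_n.+1) : 'M[algC]_n.+1 :=
  \matrix_(g1, g2) (e g1 g2)%:R.

Variables (K : fieldExtType rat) (jC : {rmorphism K -> algC}).

Definition integral_over (e : rel 'I_n.+1) : Prop :=
  forall lambda : algC, eigenvalue (adjacency e) lambda ->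
    lambda \in Aint /\ exists x : K, jC x = lambda.

Local Notation N := n.+1.
Local Notation A := (normal_frame_exists jC N).

Definition ambient : splittingFieldType rat := nf_field A.

(* The copy of K inside the ambient field. *)
Definition nfK : {subfield ambient} := (nf_inc A @: {:K})%AS.

(* zeta_(N/p) = zeta_N ^+ p for p dividing N. *)
Definition zetaD (p : nat) : ambient := nf_zeta A ^+ p.

(* Q(zeta_(N/p)). *)
Definition Qzeta (p : nat) : {subfield ambient} := <<1; zetaD p>>%AS.

Definition capF : {subfield ambient} := (nfK :&: Qzeta 1)%AS.

Definition galG (p : nat) : {set gal_of (Qzeta p)} :=
  'Gal(Qzeta p / capF :&: Qzeta p)%g.

(* The exponent a(sigma) with sigma(zeta_g) = zeta_g ^ a(sigma), g = N/p. *)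
Definition gal_exp (p : nat) (sigma : gal_of (Qzeta p)) : nat :=
  find (fun a => sigma (zetaD p) == zetaD p ^+ a) (iota 0 (N %/ p)).

Definition Gset (p : nat) : {set 'I_N} :=
  [set x : 'I_N | (1 <= x)%N && (gcdn x N == p)].

(* sigma . (p x') = p (a(sigma) x' mod g); the value is < N when x \in Gset p, *)
(* so inord is the mere injection into 'I_N.                                   *)
Definition gal_act (p : nat) (x : 'I_N) (sigma : gal_of (Qzeta p)) : 'I_N :=
  inord (p * ((gal_exp sigma * (x %/ p)) %% (N %/ p)))%N.

Definition gal_orbit (p : nat) (x : 'I_N) : {set 'I_N} :=
  [set gal_act x sigma | sigma in galG p].

(* The family of all M_i; p ranges over the positive divisors of N below N.    *)
(* No block contains 0, and 0 \in S only puts a loop at every vertex (shifting *)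
(* the eigenvalues by 1): the blocks can only account for S :\ 0.              *)
Definition galois_partition : {set {set 'I_N}} :=
  \bigcup_(p < N | (p %| N)%N) [set gal_orbit p x | x in Gset p].

End CirculantDigraph.

(* Main.v *)
Require Import Defs.
From mathcomp Require Import all_boot all_order all_fingroup all_algebra.
From mathcomp Require Import all_solvable all_field.
From mathcomp Require Import lra.

Import Order.TTheory GRing.Theory Num.Theory.
Local Open Scope ring_scope.

(** Let N = n + 1, z = zeta N and F the intersection of K with Q(z).  The
eigenvalues of the circulant digraph of S are the character sums
l_r = sum_(s in S) z ^ (r s) ([eigenvalue_circulant]).  They are algebraic
integers of Q(z), so the digraph is integral over K exactly when every l_r lies
in F ([integral_circulantP]).

Q(z) is Galois over F, so this says that every tau in Gal(Q(z) / F) fixes every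
l_r.  Now tau permutes the powers of z, say tau (z ^ s) = z ^ (pi s), so it maps
the sums of S to those of pi(S).  As z is a primitive root, a subset of Z/NZ is
determined by its character sums (a Vandermonde system, [char_sum_inj]), so the
condition becomes pi(S) = S for all tau: S is closed under the relation that
z ^ x and z ^ y are conjugate over F ([char_sum_galois]).

It remains to see that the blocks of the partition are the classes of this
relation other than {0}.  A block is an orbit of Gal(Q(z ^ p) / F') with
F' = F meet Q(z ^ p), not of Gal(Q(z) / F).  Both orbits of z ^ x are
described by a minimal polynomial, over F' and over F respectively
([gal_conjugateP]), and these two polynomials coincide: Q(z ^ p) is normal, so
all conjugates of z ^ x over F lie in it, hence so do the coefficients of the
minimal polynomial over F ([minPoly_capv]).

That z is a primitive N-th root of unity is itself an issue, because zeta N is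
the square of the N-th root of -1 which has the greatest real part among those
in the upper half plane; see [rootCN1_primitive]. *)

(** * Primitivity of zeta *)

Section RootsOfUnity.
Set Implicit Arguments.
Unset Strict Implicit.

(** For points a and b of the upper unit half-circle with b closer to 1: rotating
a back by the angle of b stays in the half-circle and moves strictly closer to
1.  The two quantities are the sine and cosine of the difference of angles. *)
Lemma real_arc_sub (R : realFieldType) (a1 a2 b1 b2 : R) :
    a1 ^+ 2 + a2 ^+ 2 = 1 -> b1 ^+ 2 + b2 ^+ 2 = 1 ->
    0 <= a2 -> 0 <= b2 -> a1 <= b1 -> b1 != 1 ->
  0 <= b1 * a2 - a1 * b2 /\ a1 < a1 * b1 + a2 * b2.
Proof.
move=> na nb a2_ge0 b2_ge0 leab b1n1.
have sqa := sqr_ge0 a2; have sqb := sqr_ge0 b2.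
have b1_le1 : b1 <= 1 by nra.
have b1_lt1 : b1 < 1 by rewrite lt_neqAle b1n1.
have a1_lt1 : a1 < 1 := le_lt_trans leab b1_lt1.
have [a1_le0 | a1_gt0] := lerP a1 0; last first.
  have b1_gt0 : 0 < b1 := lt_le_trans a1_gt0 leab.
  have le2 : b2 <= a2 by rewrite -(@ler_pXn2r _ 2) ?nnegrE //; nra.
  split; first by rewrite subr_ge0 ler_pM // ltW.
  have : b2 * b2 <= a2 * b2 by rewrite ler_wpM2r.
  nra.
split.
  have [b1_ge0 | b1_lt0] := lerP 0 b1.
    by rewrite subr_ge0 (le_trans (y := 0)) ?mulr_ge0 ?mulr_le0_ge0.
  have le2 : a2 <= b2 by rewrite -(@ler_pXn2r _ 2) ?nnegrE //; nra.
  rewrite subr_ge0 -lerN2 -!mulNr ler_pM // ?oppr_ge0 ?lerN2 //; exact: ltW.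
have a2b2 : 0 <= a2 * b2 by rewrite mulr_ge0.
have [a1_lt0 | a1_ge0] := ltrP a1 0; first by nra.
have a10 : a1 = 0 by apply/le_anti; rewrite a1_le0.
have b2_gt0 : 0 < b2 by rewrite lt_neqAle b2_ge0 andbT; apply: contraNneq b1n1; nra.
have a2_gt0 : 0 < a2 by rewrite lt_neqAle a2_ge0 andbT; apply/eqP; nra.
by rewrite a10 mul0r add0r mulr_gt0.
Qed.

Lemma arc_div (x y : algC) :
    `|x| = 1 -> `|y| = 1 -> 0 <= 'Im x -> 0 <= 'Im y -> 'Re x <= 'Re y ->
  y != 1 -> 0 <= 'Im (x / y) /\ 'Re x < 'Re (x / y).
Proof.
move=> nx ny Ix Iy leRe y1.
have := normC2_Re_Im x; have := normC2_Re_Im y.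
rewrite nx ny expr1n => ey ex.
rewrite Im_div Re_div ny expr1n !divr1.
pose r u := in_algR (Creal_Re u); pose i u := in_algR (Creal_Im u).
have y1' : r y != 1.
  apply: contraNneq y1 => /(congr1 algRval) /= Ry; rewrite eqC Ry.
  move: ey; rewrite Ry expr1n -[LHS]addr0 => /addrI/esym/eqP.
  by rewrite sqrf_eq0 => /eqP->; rewrite (Creal_ReP 1 (rpred1 _)) (Creal_ImP 1 (rpred1 _)) !eqxx.
by apply: (@real_arc_sub algR (r x) (i x) (r y) (i y)) => //; apply/val_inj.
Qed.

(** Let w be the n-th root of -1 closest to 1 in the upper half-plane.  It is also
closest to 1 among all (2n)-th roots of unity x other than 1 there: if x ^ n = 1
and x were closer, then w / x would be an n-th root of -1 closer than w.  So
division by w moves each of these x strictly towards 1, and repeating it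
reaches 1; hence x is a power of w.  Inversion takes care of the lower half, and
w generates all (2n)-th roots of unity. *)
Lemma rootCN1_primitive n : (1 < n)%N ->
  (2 * n).-primitive_root (n.-root (-1) : algC).
Proof.
move=> n_gt1; have n_gt0 := ltnW n_gt1; set w := n.-root (-1).
have N_gt0 : (0 < 2 * n)%N by rewrite muln_gt0.
have wn : w ^+ n = -1 by rewrite rootCK.
have Iw : 0 <= 'Im w by rewrite Im_rootC_ge0.
have w1 : w != 1 by apply: contra_eq_neq wn => ->; rewrite expr1n -addr_eq0 (pnatr_eq0 _ 2).
have unit_norm (x : algC) : x ^+ (2 * n) = 1 -> `|x| = 1.
  move=> xN; apply/eqP; rewrite -(@pexpr_eq1 _ _ (2 * n)) //.
  by rewrite -normrX xN normr1.
have wN : w ^+ (2 * n) = 1 by rewrite mulnC exprM wn sqrrN expr1n.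
have Re_le_w x : x ^+ (2 * n) = 1 -> x != 1 -> 0 <= 'Im x -> 'Re x <= 'Re w.
  move=> xN x1 Ix; have: x ^+ n ^+ 2 == 1 by rewrite -exprM mulnC xN.
  rewrite sqrf_eq1 => /orP[/eqP xn1 | /eqP xn]; last exact: rootC_Re_max.
  rewrite real_leNgt ?Creal_Re //; apply/negP => /ltW ltRe.
  have [Iwx ltR] := arc_div (unit_norm _ wN) (unit_norm _ xN) Iw Ix ltRe x1.
  have: 'Re (w / x) <= 'Re w.
    by apply: rootC_Re_max => //; rewrite expr_div_n wn xn1 divr1.
  by rewrite real_leNgt ?Creal_Re // ltR.
have [v prim_v] := C_prim_root_exists N_gt0.
have upper_pow x : x ^+ (2 * n) = 1 -> 0 <= 'Im x -> exists k, x = w ^+ k.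
  (* Descent on the number of (2n)-th roots of unity lying closer to 1 than x. *)
  pose above u := [set j : 'I_(2 * n) | 'Re u < 'Re (v ^+ j)].
  have [c] := ubnP #|above x|; elim: c x => // c IHc x lexc xN Ix.
  have [-> | x1] := eqVneq x 1; first by exists 0%N.
  have [Ixw ltR] := arc_div (unit_norm _ xN) (unit_norm _ wN) Ix Iw
                      (Re_le_w _ xN x1 Ix) w1.
  have xwN : (x / w) ^+ (2 * n) = 1 by rewrite expr_div_n xN wN divr1.
  have [||//|k Dk] := IHc (x / w).
  - rewrite ltnS in lexc; apply: leq_trans lexc; apply: proper_card; apply/properP; split.
      by apply/subsetP=> j; rewrite !inE; apply: lt_trans.
    have [j Dj] := prim_rootP prim_v xwN.
    by exists j; rewrite !inE -Dj // ltxx.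
  - exact: xwN.
  exists k.+1; rewrite exprSr -Dk divfK //.
  by apply: contra_eq_neq wn => ->; rewrite expr0n gtn_eqF // eq_sym oppr_eq0 oner_eq0.
have v_pow : exists k, v = w ^+ k.
  have vN := prim_expr_order prim_v.
  have [Iv | Iv] := real_leP (rpred0 _) (Creal_Im v); first exact: upper_pow.
  have [||k Dk] := upper_pow v^-1.
  - by rewrite exprVn vN invr1.
  - by rewrite ImV (unit_norm _ vN) expr1n divr1 oppr_ge0 ltW.
  exists ((2 * n).-1 * k)%N; rewrite mulnC exprM -Dk; apply: (mulfI (x := v^-1)).
    by rewrite invr_eq0 (prim_root_eq0 prim_v) gtn_eqF.
  by rewrite -exprS prednK // exprVn vN invr1 mulVf // (prim_root_eq0 prim_v) gtn_eqF.
have [k Dv] := v_pow; have [m prim_w dv_m] := prim_order_exists N_gt0 wN.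
suffices -> : (2 * n)%N = m by [].
apply/eqP; rewrite eqn_dvd dv_m andbT (prim_order_dvd prim_v) Dv exprAC.
by rewrite (prim_expr_order prim_w) expr1n.
Qed.

Lemma zeta_primitive n : n.+1.-primitive_root (zeta n.+1).
Proof.
rewrite /zeta; case: n => [|n].
  by rewrite root1C sqrrN expr1n; apply/andP; split=> //; apply/forallP=> i;
    rewrite ord1 unity_rootE eqxx.
have := exp_prim_root (rootCN1_primitive (isT : 1 < n.+2)%N) 2.
by rewrite (gcdn_idPl _) ?dvdn_mulr // mulKn.
Qed.

End RootsOfUnity.

(** * Spectrum of circulant digraphs *)

Section CharacterSums.
Set Implicit Arguments.
Unset Strict Implicit.

Variables (F : fieldType) (n : nat) (w : F).
Hypothesis prim_w : n.+1.-primitive_root w.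

Definition char_sum (S : {set 'I_n.+1}) (r : 'I_n.+1) : F :=
  \sum_(s in S) w ^+ (r * s).

Lemma prim_expr_inj : injective (fun i : 'I_n.+1 => w ^+ i).
Proof.
move=> i j /eqP; rewrite (eq_prim_root_expr prim_w) !modn_small //.
by move/eqP/val_inj.
Qed.

Lemma prim_exprMD (r : nat) (i j : 'I_n.+1) :
  w ^+ (r * (i + j)%R) = w ^+ (r * i) * w ^+ (r * j).
Proof.
by rewrite -exprD -mulnDr mulnC exprM /= (prim_expr_mod prim_w) -exprM mulnC.
Qed.

(** The vanishing of all Fourier coefficients is a linear system with the
Vandermonde matrix of the distinct powers of w. *)
Lemma fourier_eq0 (f : 'I_n.+1 -> F) :
  (forall r : 'I_n.+1, \sum_s f s * w ^+ (r * s) = 0) -> f =1 fun=> 0.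
Proof.
move=> f0 i; pose V := Vandermonde n.+1 (\row_(j < n.+1) w ^+ j).
have unitV : V \in unitmx.
  rewrite unitmxE det_Vandermonde unitfE; apply/prodf_neq0 => j _.
  apply/prodf_neq0 => k ltjk; rewrite !mxE subr_eq0.
  by apply: contraTneq ltjk => /prim_expr_inj->; rewrite ltnn.
have: V *m (\col_s f s) = 0.
  apply/matrixP => r k; rewrite !mxE -[RHS](f0 r); apply: eq_bigr => s _.
  by rewrite !mxE mulrC -exprM mulnC.
move/(congr1 (mulmx (invmx V))); rewrite mulKmx // mulmx0.
by move/matrixP/(_ i 0); rewrite !mxE.
Qed.

Lemma char_sum_inj (S T : {set 'I_n.+1}) : char_sum S =1 char_sum T -> S = T.
Proof.
have sumE (A : {set 'I_n.+1}) (r : 'I_n.+1) :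
    \sum_s (s \in A)%:R * w ^+ (r * s) = char_sum A r.
  rewrite /char_sum [RHS]big_mkcond; apply: eq_bigr => s _.
  by case: (s \in A); rewrite ?mul1r ?mul0r.
move=> eqST; apply/setP => i.
have /fourier_eq0/(_ i)/eqP : forall r : 'I_n.+1,
    \sum_s ((s \in S)%:R - (s \in T)%:R) * w ^+ (r * s) = 0.
  move=> r; under eq_bigr do rewrite mulrBl.
  by rewrite big_split sumrN /= !sumE eqST subrr.
rewrite subr_eq0; case: (i \in S); case: (i \in T) => //=.
  by rewrite oner_eq0.
by rewrite eq_sym oner_eq0.
Qed.

End CharacterSums.

(** The columns (w ^ (r h))_h are eigenvectors of the adjacency matrix A.  If
v A = lambda v and lambda is none of the character sums, pairing v with these
columns shows that every Fourier coefficient of v vanishes, so v = 0. *)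
Lemma eigenvalue_circulant n (w : algC) (S : {set 'I_n.+1}) (lambda : algC) :
  n.+1.-primitive_root w ->
  eigenvalue (adjacency (circulant S)) lambda <->
    exists r, lambda = char_sum w S r.
Proof.
move=> prim_w; set A := adjacency _; split=> [/eigenvalueP[v vA v_neq0] | [r ->]].
  have rowE (r g : 'I_n.+1) :
      \sum_h A g h * w ^+ (r * h) = char_sum w S r * w ^+ (r * g).
    rewrite (reindex_inj (addrI g)) /= mulr_suml [RHS]big_mkcond.
    apply: eq_bigr => s _; rewrite mxE /circulant addrC addrA addNr add0r.
    rewrite (prim_exprMD prim_w).
    by case: (s \in S); rewrite ?mul1r ?mul0r // mulrC.
  suffices /existsP[r /eqP-> ] : [exists r, lambda == char_sum w S r] by exists r.
  apply: contra_neqT v_neq0 => /existsPn no_r.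
  apply/rowP => i; rewrite [RHS]mxE; apply: (fourier_eq0 prim_w) => r.
  apply: (@mulfI _ (lambda - char_sum w S r)); first by rewrite subr_eq0.
  apply/eqP; rewrite mulr0 mulrBl subr_eq0 !mulr_sumr; apply/eqP.
  transitivity (\sum_h (v *m A) 0 h * w ^+ (r * h)).
    by apply: eq_bigr => h _; rewrite vA mxE mulrA.
  under eq_bigr => h _ do rewrite mxE mulr_suml.
  rewrite exchange_big; apply: eq_bigr => g _ /=.
  under eq_bigr => h _ do rewrite -mulrA.
  by rewrite -mulr_sumr rowE mulrCA.
apply/eigenvalueP; exists (\row_h w ^+ (r * (- h)%R)).
  apply/rowP => h; rewrite !mxE (reindex_inj (can_inj (subKr h))).
  rewrite mulr_suml [RHS]big_mkcond; apply: eq_bigr => s _.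
  rewrite !mxE /circulant subKr opprB (prim_exprMD prim_w).
  by case: (s \in S); rewrite ?mulr1 ?mulr0.
apply/eqP => /rowP/(_ 0)/eqP; rewrite !mxE expf_eq0.
by rewrite (prim_root_eq0 prim_w) andbF.
Qed.

(** * Conjugates in normal extensions *)

Section GaloisConjugates.
Set Implicit Arguments.
Unset Strict Implicit.

Variables (F0 : fieldType) (L : splittingFieldType F0).
Implicit Types (K E : {subfield L}) (a b w : L).

Lemma cyclotomic_normalField m w :
  m.-primitive_root w -> normalField 1 <<1; w>>.
Proof.
move=> prim_w; apply/(splitting_normalField (sub1v _)).
exists ('X^m - 1); first by rewrite rpredB ?rpredX ?polyOverX ?rpred1.
exists [seq w ^+ i | i <- index_iota 0 m].
  by rewrite -(factor_Xn_sub_1 prim_w) big_map eqpxx.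
apply/eqP; rewrite eqEsubv; apply/andP; split.
  apply/Fadjoin_seqP; split=> [|_ /mapP[i _ ->]]; first exact: subv_adjoin.
  by rewrite rpredX // memv_adjoin.
apply/FadjoinP; split; first exact: subv_adjoin_seq.
have m_gt0 := prim_order_gt0 prim_w.
have [m1|m_neq1] := eqVneq m 1%N.
  have := prim_expr_order prim_w; rewrite m1 expr1 => ->; exact: rpred1.
apply/seqv_sub_adjoin/mapP; exists 1%N; rewrite ?expr1 // mem_index_iota /=.
by rewrite ltn_neqAle eq_sym m_neq1.
Qed.

Lemma gal_conjugateP K E a b : (K <= E)%VS -> normalField K E -> a \in E ->
  (exists2 x, x \in 'Gal(E / K)%g & x a = b) <-> root (minPoly K a) b.
Proof.
move=> sKE nKE Ea; split=> [[x galx <-] | ]; first exact: root_minPoly_gal galx Ea.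
exact: normalField_root_minPoly.
Qed.

(** All conjugates of a over K lie in the normal field E, so the minimal
polynomial over K already has its coefficients in E.  The case of interest is
K = F and E = Q(z ^ p), which in general does not contain F. *)
Lemma minPoly_capv K E a :
  normalField K E -> a \in E -> minPoly (K :&: E) a = minPoly K a.
Proof.
move=> /normalFieldP nKE Ea; apply/eqP; rewrite -eqp_monic ?monic_minPoly //.
rewrite /eqp (minPolyS a (capvSl K E)) andbT; apply: minPoly_dvdp (root_minPoly K a).
have [r /allP Er splitKa] := nKE a Ea.
apply/polyOverP => i; rewrite memv_cap (polyOverP (minPolyOver K a)) /=.
have /polyOverP/(_ i) : minPoly K a \is a polyOver E; last by [].
by rewrite splitKa big_seq; apply: rpred_prod => b rb; rewrite polyOverXsubC Er.
Qed.

End GaloisConjugates.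

(** * Galois classes of residues *)

Section Frame.
Set Implicit Arguments.
Unset Strict Implicit.

Variables (n : nat) (K : fieldExtType rat) (jC : {rmorphism K -> algC}).

Local Notation N := n.+1.
Local Notation A := (normal_frame_exists jC N).
Local Notation z := (nf_zeta A).
Local Notation F := (capF n jC).
Local Notation Qz := (Qzeta n jC).

Lemma nf_zeta_primitive : N.-primitive_root z.
Proof.
rewrite -(fmorph_primitive_root (nf_val A)) nf_zetaP; exact: zeta_primitive.
Qed.

(** Conjugacy of z ^ x and z ^ y over F, expressed by a minimal polynomial so that
it makes no reference to the field in which the automorphisms act. *)
Definition galois_conj (x y : 'I_N) : bool := root (minPoly F (z ^+ x)) (z ^+ y).

Lemma zetaD_primitive p : (p %| N)%N -> (N %/ p).-primitive_root (zetaD n jC p).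
Proof. by move=> pN; have := exp_prim_root nf_zeta_primitive p; rewrite (gcdn_idPl pN). Qed.

Lemma normal_Qzeta (k : {subfield ambient n jC}) p :
  (p %| N)%N -> normalField k (Qz p).
Proof.
move=> pN; apply: (normalFieldS (sub1v _)).
exact: cyclotomic_normalField (zetaD_primitive pN).
Qed.

Lemma zeta_expr_Gset p x : x \in Gset n p -> z ^+ x \in Qz p.
Proof.
rewrite inE => /andP[_ /eqP Dp].
have /divnK {1}<- : (p %| x)%N by rewrite -Dp dvdn_gcdl.
by rewrite mulnC exprM rpredX // memv_adjoin.
Qed.

Lemma gal_actE p x (sigma : gal_of (Qz p)) :
  (p %| N)%N -> x \in Gset n p -> z ^+ gal_act x sigma = sigma (z ^+ x).
Proof.
move=> pN; rewrite inE => /andP[_ /eqP Dp].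
have /divnK Dx : (p %| x)%N by rewrite -Dp dvdn_gcdl.
have p_gt0 : (0 < p)%N by rewrite (dvdn_gt0 _ pN).
have prim_zp := zetaD_primitive pN.
have has_exp : has (fun a => sigma (zetaD n jC p) == zetaD n jC p ^+ a)
                 (iota 0 (N %/ p)).
  have [|i Di] := @prim_rootP _ _ _ prim_zp (sigma (zetaD n jC p)).
    by rewrite -rmorphXn (prim_expr_order prim_zp) rmorph1.
  by apply/hasP; exists (val i); rewrite ?mem_iota ?ltn_ord //= Di.
have Dsigma : sigma (zetaD n jC p) = zetaD n jC p ^+ gal_exp sigma.
  have := nth_find 0%N has_exp; rewrite nth_iota ?add0n; first by move/eqP.
  by move: has_exp; rewrite has_find size_iota.
rewrite /gal_act inordK; last first.
  by rewrite -[ltnRHS](divnK pN) mulnC ltn_pmul2r // ltn_mod divn_gt0 // dvdn_leq.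
rewrite exprM -/(zetaD n jC p) (prim_expr_mod prim_zp) exprM -Dsigma -rmorphXn.
by rewrite /zetaD -exprM mulnC Dx.
Qed.

(** The orbit under Gal(Q(z ^ p) / F meet Q(z ^ p)) is a conjugacy class over F
itself, because z ^ x has the same minimal polynomial over both base fields. *)
Lemma mem_gal_orbit p x y :
  (p %| N)%N -> x \in Gset n p -> (y \in gal_orbit jC p x) = galois_conj x y.
Proof.
move=> pN px; have Ex := zeta_expr_Gset px.
rewrite /galois_conj -(minPoly_capv (normal_Qzeta _ pN) Ex).
have conjP b := gal_conjugateP b (capvSr F (Qz p))
  (normal_Qzeta (F :&: Qz p) pN) Ex.
apply/imsetP/idP=> [[sigma galF ->] | /conjP[sigma galF Dy]].
  by apply/conjP; exists sigma; rewrite // gal_actE.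
by exists sigma => //; apply: (prim_expr_inj nf_zeta_primitive); rewrite /= gal_actE.
Qed.

Lemma galois_Qzeta : galois F (Qz 1).
Proof.
apply/and3P; split; [exact: capvSr | | exact: normal_Qzeta].
apply/separableP => a _; apply: pcharf0_separable => q.
by rewrite pchar_lalg pchar_num.
Qed.

Lemma zeta_expr_Qz1 (x : 'I_N) : z ^+ x \in Qz 1.
Proof. by rewrite rpredX // -[z]expr1 memv_adjoin. Qed.

Lemma char_sum_Qz1 (S : {set 'I_N}) r : char_sum z S r \in Qz 1.
Proof.
by apply: rpred_sum => s _; rewrite mulnC exprM rpredX // zeta_expr_Qz1.
Qed.

Lemma galois_conjP (x y : 'I_N) :
  reflect (exists2 tau, tau \in 'Gal(Qz 1 / F)%g & tau (z ^+ x) = z ^+ y)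
          (galois_conj x y).
Proof.
have /and3P[sFE _ nFE] := galois_Qzeta.
by apply: (iffP idP) => /(gal_conjugateP (z ^+ y) sFE nFE (zeta_expr_Qz1 x)).
Qed.

Lemma galois_conj_refl x : galois_conj x x.
Proof. exact: root_minPoly. Qed.

Lemma galois_conj_trans x y t :
  galois_conj x y -> galois_conj y t -> galois_conj x t.
Proof.
move=> /galois_conjP[tau galt Dy] /galois_conjP[nu galn Dt].
apply/galois_conjP; exists (tau * nu)%g; first exact: groupM.
by rewrite galM ?zeta_expr_Qz1 // Dy.
Qed.

Lemma galois_conj0 x : galois_conj x 0 -> x = 0.
Proof.
move=> /galois_conjP[tau _ /eqP]; rewrite expr0 fmorph_eq1 => /eqP z1.
by apply: (prim_expr_inj nf_zeta_primitive); rewrite z1.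
Qed.

Lemma galois_0conj x : galois_conj 0 x -> x = 0.
Proof.
move=> /galois_conjP[tau _]; rewrite expr0 rmorph1 => z1.
by apply: (prim_expr_inj nf_zeta_primitive); rewrite -z1.
Qed.

(** An automorphism tau acts on exponents by a permutation pi and sends the sums of
S to those of pi(S); all of these agree only if pi(S) = S. *)
Lemma char_sum_galois (S : {set 'I_N}) :
  (forall r, char_sum z S r \in F) <->
  (forall x y, x \in S -> galois_conj x y -> y \in S).
Proof.
have expP (tau : gal_of (Qz 1)) (x : 'I_N) : {y : 'I_N | tau (z ^+ x) = z ^+ y}.
  apply: (prim_rootP nf_zeta_primitive).
  by rewrite -rmorphXn exprAC (prim_expr_order nf_zeta_primitive) expr1n rmorph1.
pose pi tau x := sval (expP tau x).
have piP tau x : z ^+ pi tau x = tau (z ^+ x) by rewrite /pi; case: (expP tau x).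
have pi_inj tau : injective (pi tau).
  move=> x y eqxy; apply: (prim_expr_inj nf_zeta_primitive).
  have : tau (z ^+ x) = tau (z ^+ y) by rewrite -!piP eqxy.
  exact: fmorph_inj.
have sumE (tau : gal_of (Qz 1)) r :
    tau (char_sum z S r) = char_sum z (pi tau @: S) r.
  rewrite /char_sum rmorph_sum big_imset /=; last by move=> u v _ _; apply: pi_inj.
  by apply: eq_bigr => s _; rewrite mulnC exprM rmorphXn /= -piP -exprM mulnC.
split=> [sumF x y Sx /galois_conjP[tau galt Dy] | closedS r].
  have <- : pi tau @: S = S.
    apply: (char_sum_inj nf_zeta_primitive) => r.
    by rewrite -sumE (fixed_gal (capvSr _ _) galt).
  suffices -> : y = pi tau x by apply: imset_f.
  by apply: (prim_expr_inj nf_zeta_primitive); rewrite piP.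
rewrite -(galois_fixedField galois_Qzeta).
apply/fixedFieldP => [|tau]; [exact: char_sum_Qz1 | move=> galt].
rewrite sumE; congr (char_sum z _ r).
apply/eqP; rewrite eqEcard card_imset // leqnn andbT.
apply/subsetP => _ /imsetP[x Sx ->]; apply: closedS Sx _.
by apply/galois_conjP; exists tau; rewrite ?piP.
Qed.

Lemma integral_circulantP (S : {set 'I_N}) :
  integral_over jC (circulant S) <-> forall r, char_sum z S r \in F.
Proof.
have valE r : nf_val A (char_sum z S r) = char_sum (zeta N) S r.
  by rewrite rmorph_sum; apply: eq_bigr => s _; rewrite rmorphXn nf_zetaP.
have eigP := eigenvalue_circulant S _ (zeta_primitive n).
split=> [intS r | sumF lambda /eigP[r ->]].
  rewrite memv_cap; apply/andP; split.
    have [|_ [x Dx]] := intS (char_sum (zeta N) S r); first by apply/eigP; exists r.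
    have -> : char_sum z S r = nf_inc A x.
      by apply: (fmorph_inj (nf_val A)); rewrite valE nf_incP.
    by rewrite memv_img ?memvf.
  exact: char_sum_Qz1.
split.
  apply: rpred_sum => s _.
  by rewrite rpredX // (Aint_prim_root (zeta_primitive n)).
have := sumF r; rewrite memv_cap => /andP[/memv_imgP[x _ Dx] _].
by exists x; rewrite -(nf_incP A) -Dx valE.
Qed.

Lemma galois_partitionP (B : {set 'I_N}) :
  reflect (exists2 x, x != 0 & B = [set y | galois_conj x y])
          (B \in galois_partition n jC).
Proof.
have orbitE p x : (p %| N)%N -> x \in Gset n p ->
    gal_orbit jC p x = [set y | galois_conj x y].
  by move=> pN px; apply/setP=> y; rewrite inE mem_gal_orbit.
apply: (iffP bigcupP) => [[p pN /imsetP[x px ->]] | [x x_neq0 ->]].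
  exists x; last exact: orbitE.
  by move: px; rewrite inE => /andP[x_gt0 _]; rewrite -val_eqE -lt0n.
have x_gt0 : (0 < x)%N by rewrite lt0n.
have lt_p : (gcdn x N < N)%N.
  by apply: leq_ltn_trans (ltn_ord x); rewrite dvdn_leq ?dvdn_gcdl.
exists (Ordinal lt_p); first exact: dvdn_gcdr.
have px : x \in Gset n (gcdn x N) by rewrite inE x_gt0 eqxx.
by apply/imsetP; exists x; rewrite //= orbitE ?dvdn_gcdr.
Qed.

End Frame.

(** * Integral circulant digraphs *)

Theorem mainTheorem1 (K : fieldExtType rat) (jC : {rmorphism K -> algC})
    (n : nat) (S : {set 'I_n.+1}) :
  integral_over jC (circulant S) <->
  exists P : {set {set 'I_n.+1}},
    P \subset galois_partition n jC /\ S :\ 0 = cover P.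
Proof.
apply: (iff_trans (integral_circulantP jC S)).
apply: (iff_trans (char_sum_galois jC S)).
split=> [closedS | [P [/subsetP sP defS]] x y Sx xy].
  exists [set B in galois_partition n jC | B \subset S :\ 0]; split.
    by apply/subsetP=> B; rewrite inE => /andP[].
  apply/eqP; rewrite eqEsubset; apply/andP; split; last first.
    by apply/bigcupsP => B; rewrite inE => /andP[].
  apply/subsetP => x /setD1P[x_neq0 Sx]; apply/bigcupP.
  exists [set y | galois_conj jC x y]; last by rewrite inE galois_conj_refl.
  rewrite inE; apply/andP; split; first by apply/galois_partitionP; exists x.
  apply/subsetP => y; rewrite inE => xy; rewrite in_setD1 (closedS x) // andbT.
  by apply: contraNneq x_neq0 => y0; apply/eqP/(galois_conj0 (jC := jC)); rewrite -y0.
have [x0 | x_neq0] := eqVneq x 0.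
  by rewrite x0 in Sx xy; rewrite (galois_0conj xy).
have : x \in cover P by rewrite -defS in_setD1 x_neq0.
case/bigcupP => B PB Bx; have /galois_partitionP[t _ defB] := sP B PB.
suffices : y \in S :\ 0 by case/setD1P.
rewrite defS; apply/bigcupP; exists B => //.
by move: Bx; rewrite defB !inE => tx; apply: galois_conj_trans tx xy.
Qed.
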